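(* Let $g$ be a positive integer, let $q$ be a prime power and let $h\ge2$ be an integer such that $q^{k}\equiv1\pmod g$ for some positive integer $k$ with $k\mid h$ and $k\ne h$. Then there exists a subset $A\subseteq\mathbb{Z}_{(q^h-1)/g}$ with $|A|=q$ such that $A\in B_h[g]\big(\mathbb{Z}_{(q^h-1)/g}\big)$.
   Context: $\mathbb{Z}_N$ denotes the additive cyclic group of integers modulo $N$. For an additive abelian group $G$, a subset $A\subseteq G$ and positive integers $h\ge 2$, $g$, we write $A\in B_h[g](G)$ if every $b\in G$ has at most $g$ distinct representations $b=a_1+\cdots+a_h$ with $a_1,\dots,a_h\in A$, counted up to reordering of the summands. *)

(* Defs.v *)
From mathcomp Require Import all_boot all_order all_algebra.

Set Implicit Arguments.
Unset Strict Implicit.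
Unset Printing Implicit Defensive.

Definition prime_power (q : nat) : Prop :=
  exists p m : nat, [/\ prime p, 0 < m & q = p ^ m].

Definition represents (G : zmodType) (A : {pred G}) (h : nat) (b : G)
    (a : h.-tuple G) : Prop :=
  {subset a <= A} /\ (\sum_(i < h) tnth a i)%R = b.

(* A \in B_h[g](G).  Representations differing only in the order of their
   summands are identified, so "at most g representations of b" says that a list
   of representations of b no two of which are permutations of each other has
   at most g entries. *)
Definition Bhg (h g : nat) (G : zmodType) (A : {pred G}) : Prop :=
  forall (b : G) (reps : seq (h.-tuple G)),
    (forall a, a \in reps -> represents A b a) ->
    pairwise (fun a a' : h.-tuple G => ~~ perm_eq a a') reps ->
    size reps <= g.

(* Main.v *)
(* A variant of the Bose-Chowla construction. Let z be a primitive element of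
   the field with q ^ h elements and N = (q ^ h - 1) / g, so that z ^ g is a
   primitive N-th root of unity and x |-> (z ^ g) ^ x embeds Z/N into the
   multiplicative group. Take for A the preimage of the elements (z - a) ^ g
   with a in F_q. A representation of b by a_1, ..., a_h in F_q is then a product
   of the z - a_i whose g-th power is prescribed by b, so that this product takes
   at most g values. Each value determines the multiset of the a_i: applying
   Frobenius, two monic polynomials of degree h taking the same value at z take
   the same values at all the h conjugates of z. Finally a |-> (z - a) ^ g is
   injective on F_q: otherwise z would lie in the proper subfield F_(q^k), which
   contains the g-th roots of unity. *)

Require Import Defs.
From mathcomp Require Import all_boot all_order all_algebra.
From mathcomp Require Import cyclic finfield.

Set Implicit Arguments.
Unset Strict Implicit.
Unset Printing Implicit Defensive.

Import GRing.Theory.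

Section Frobenius.

Variables (R : comNzRingType) (q : nat).
Hypothesis charq : [pchar R]%R.-nat q.

Lemma exprBn_pchar_iter i (x y : R) :
  ((x - y) ^+ (q ^ i) = x ^+ (q ^ i) - y ^+ (q ^ i))%R.
Proof.
have charqi : [pchar R]%R.-nat (q ^ i) by rewrite pnatX charq.
by rewrite exprDn_pchar // exprNn_pchar.
Qed.

Lemma expr_fixed_iter i (x : R) : (x ^+ q = x -> x ^+ (q ^ i) = x)%R.
Proof.
by move=> xq; elim: i => [|i IHi]; rewrite ?expr1 // expnS exprM xq.
Qed.

End Frobenius.

Section PolynomialLemmas.

Variable F : fieldType.
Local Open Scope ring_scope.

(** The leading terms cancel, so [p - r] has degree less than that of [p], too small for the
    [size rs] distinct roots it has unless it vanishes. *)
Lemma eq_monic_roots (p r : {poly F}) (rs : seq F) :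
    p \is monic -> r \is monic -> size p = size r ->
    uniq rs -> (size p <= (size rs).+1)%N ->
    {in rs, forall x, p.[x] = r.[x]} ->
  p = r.
Proof.
move=> p_mon r_mon eq_sz urs sz_p eq_pr; apply/eqP; rewrite -subr_eq0.
apply: contraLR sz_p => nz_pr; rewrite -ltnNge.
have rootP_rs: all (root (p - r)) rs.
  by apply/allP=> x /eq_pr eq_x; rewrite rootE hornerD hornerN eq_x subrr.
apply: leq_ltn_trans (max_poly_roots nz_pr rootP_rs urs) _.
have sz_p0: (0 < size p)%N by rewrite size_poly_gt0 monic_neq0.
rewrite -(prednK sz_p0) ltnS; apply/leq_sizeP => j le_pj.
rewrite coefB; case: (ltngtP (size p).-1 j) le_pj => // [lt_pj _|<- _].
  have le_pj: (size p <= j)%N by rewrite -(prednK sz_p0).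
  by rewrite !nth_default ?subrr // -eq_sz.
by rewrite -lead_coefE eq_sz -lead_coefE (monicP p_mon) (monicP r_mon) subrr.
Qed.

Lemma uniq_roots_of_power (n : nat) (c : F) (rs : seq F) :
  (0 < n)%N -> uniq rs -> {in rs, forall x, x ^+ n = c} -> (size rs <= n)%N.
Proof.
move=> n0 urs rs_c; rewrite -ltnS -(size_XnsubC c n0).
apply: max_poly_roots urs; first by rewrite monic_neq0 ?monicXnsubC.
by apply/allP => x /rs_c xc; rewrite rootE !hornerE xc subrr.
Qed.

Lemma perm_eq_prod_fixed (q h : nat) (z : F) (s t : seq F) :
    [pchar F]%R.-nat q -> uniq [seq z ^+ (q ^ i) | i <- iota 0 h] ->
    size s = h -> size t = h ->
    {in s, forall x, x ^+ q = x} -> {in t, forall x, x ^+ q = x} ->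
  \prod_(x <- s) (z - x) = \prod_(x <- t) (z - x) -> perm_eq s t.
Proof.
move=> charq uz sz_s sz_t fix_s fix_t eq_st; apply: prod_XsubC_eq.
apply: (eq_monic_roots (rs := [seq z ^+ (q ^ i) | i <- iota 0 h])) => //.
- exact: monic_prod_XsubC.
- exact: monic_prod_XsubC.
- by rewrite !size_prod_XsubC sz_s sz_t.
- by rewrite size_prod_XsubC sz_s size_map size_iota.
have conj r i : {in r, forall x, x ^+ q = x} ->
    (\prod_(x <- r) ('X - x%:P)).[z ^+ (q ^ i)]
      = (\prod_(x <- r) (z - x)) ^+ (q ^ i).
  move=> fix_r; rewrite horner_prod -prodrXl; apply: eq_big_seq => x xr.
  by rewrite !hornerE exprBn_pchar_iter // (expr_fixed_iter _ (fix_r x xr)).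
by move=> _ /mapP[i _ ->]; rewrite !conj // eq_st.
Qed.

End PolynomialLemmas.

Section FiniteField.

Variable F : finFieldType.
Local Open Scope ring_scope.

Lemma finField_prim_root : {z : F | (#|F|.-1).-primitive_root z}.
Proof.
have card_gt1 := finNzRing_gt1 F.
have /hasP/sig2W[z _ z_prim] :
    has (#|F|.-1).-primitive_root (enum (predC1 (0 : F))).
  apply: has_prim_root; rewrite ?enum_uniq //; first by rewrite -ltnS prednK // ltnW.
  - apply/allP => x; rewrite mem_enum inE => nz_x; apply/unity_rootP.
    by apply: (mulfI nz_x); rewrite -exprS prednK ?expf_card ?mulr1 // ltnW.
  - by rewrite -cardE cardC1.
by exists z.
Qed.

(** Besides 0, the fixed points are the roots of unity of order dividing [q - 1]. As [q - 1] divides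
    [q ^ h - 1], a power of a primitive element generates all of them. *)
Lemma card_expr_fixed (q h : nat) :
  (1 < q)%N -> #|F| = (q ^ h)%N -> #|[set x : F | x ^+ q == x]| = q.
Proof.
move=> q_gt1 cardF; have [y y_prim] := finField_prim_root.
have := dvdn_prim_root y_prim; rewrite cardF => /(_ _ (dvdn_pred_predX q h)).
move: (y ^+ _) => z z_prim.
have nz_z: z != 0 by rewrite (prim_root_eq0 z_prim) -lt0n -ltnS prednK // ltnW.
have ->: [set x : F | x ^+ q == x] = 0 |: [set z ^+ i | i : 'I_q.-1].
  apply/setP => x; rewrite !inE; have [-> | nz_x] := eqVneq x 0.
    by rewrite expr0n gtn_eqF ?eqxx // ltnW.
  rewrite -{1}(prednK (ltnW q_gt1)) exprS -[X in _ == X]mulr1 (inj_eq (mulfI nz_x)).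
  apply/eqP/imsetP => [/(prim_rootP z_prim)[i ->]|[i _ ->]]; first by exists i.
  by rewrite exprAC (prim_expr_order z_prim) expr1n.
rewrite cardsU1 card_imset ?card_ord.
  case: imsetP => [[i _ /eqP]|_].
    by rewrite eq_sym expf_eq0 (negPf nz_z) andbF.
  by rewrite add1n prednK // ltnW.
move=> i j /eqP; rewrite (eq_prim_root_expr z_prim) !modn_small //.
by move/eqP/val_inj.
Qed.

End FiniteField.

Section ZpCharacter.

Variables (F : fieldType) (n : nat) (w : F).
Hypothesis w_prim : (n.+2).-primitive_root%R w.
Local Open Scope ring_scope.

Lemma expr_Zp_inj : injective (fun x : 'I_n.+2 => w ^+ x).
Proof.
move=> x y /eqP; rewrite (eq_prim_root_expr w_prim) !modn_small //.
by move/eqP/val_inj.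
Qed.

Lemma expr_Zp_sum (I : Type) (r : seq I) (f : I -> 'I_n.+2) :
  w ^+ (\sum_(i <- r) f i)%R = \prod_(i <- r) w ^+ f i.
Proof.
apply: (big_morph (fun x : 'I_n.+2 => w ^+ x)) => // x y.
by rewrite (prim_expr_mod w_prim) exprD.
Qed.

End ZpCharacter.

(** The exponents [q ^ i] with [i < h] are distinct and smaller than the order of [z], so none of
    them is reduced. For [q = 2] this bound uses [1 < h]. *)
Lemma uniq_prim_root_conjugates (F : fieldType) (q h : nat) (z : F) :
    1 < q -> 1 < h -> ((q ^ h).-1).-primitive_root%R z ->
  uniq [seq (z ^+ (q ^ i))%R | i <- iota 0 h].
Proof.
move=> q_gt1 h_gt1 z_prim; rewrite map_inj_in_uniq ?iota_uniq // => i j.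
rewrite !mem_iota !add0n /= => lt_ih lt_jh /eqP.
have small l : l < h -> q ^ l < (q ^ h).-1.
  case: h h_gt1 {z_prim lt_ih lt_jh} => // h h_gt0; rewrite ltnS => le_lh.
  rewrite -ltnS prednK ?expn_gt0 ?(ltnW q_gt1) //.
  have le_l: q ^ l <= q ^ h by rewrite leq_exp2l.
  have qh: 1 < q ^ h by rewrite -(expn0 q) ltn_exp2l.
  apply: leq_trans (_ : 2 * q ^ h <= _); last by rewrite expnS leq_mul2r q_gt1 orbT.
  by rewrite mul2n -addnn -addn2 addnC leq_add.
rewrite (eq_prim_root_expr z_prim) !modn_small ?small // => /eqP.
by move/eqP; rewrite eqn_exp2l // => /eqP.
Qed.

Lemma expr_subr_fixed_inj (F : fieldType) (g q k : nat) (z x y : F) :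
    [pchar F]%R.-nat q -> (g %| (q ^ k).-1) -> 0 < q ->
    (z ^+ (q ^ k) != z)%R ->
    (x ^+ q = x)%R -> (y ^+ q = y)%R ->
  ((z - x) ^+ g = (z - y) ^+ g)%R -> x = y.
Proof.
move=> charq g_dv q_gt0 nfix_z fix_x fix_y eq_g.
have nz_y: (z - y != 0)%R.
  by apply: contra_neq nfix_z => /subr0_eq ->; apply: expr_fixed_iter.
pose u := ((z - x) / (z - y))%R.
have def_zx: (z - x = u * (z - y))%R by rewrite divfK.
have ug: (u ^+ g = 1)%R by rewrite expr_div_n eq_g divff ?expf_neq0.
(* u is a g-th root of unity and g divides q ^ k - 1, so u lies in F_(q^k). *)
have fix_u: (u ^+ (q ^ k) = u)%R.
  rewrite -(prednK (_ : 0 < q ^ k)) ?expn_gt0 ?q_gt0 // exprS.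
  by case/dvdnP: g_dv => l ->; rewrite mulnC exprM ug expr1n mulr1.
have def_zqx: (z ^+ (q ^ k) - x = u * (z ^+ (q ^ k) - y))%R.
  have := congr1 (fun v => v ^+ (q ^ k))%R def_zx.
  by rewrite exprMn fix_u !exprBn_pchar_iter // (expr_fixed_iter k fix_x) (expr_fixed_iter k fix_y).
have nz_d: (z ^+ (q ^ k) - z != 0)%R by rewrite subr_eq0.
(* Subtracting [def_zx] from its Frobenius image [def_zqx] eliminates [x] and [y], leaving a nonzero
   factor to cancel. *)
have u1: (1 = u)%R.
  apply: (mulIf nz_d); rewrite mul1r.
  have dE v : (z ^+ (q ^ k) - z = z ^+ (q ^ k) - v - (z - v))%R.
    by rewrite opprB addrA subrK.
  by rewrite {1}(dE x) (dE y) mulrBr -def_zqx -def_zx.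
by move: def_zx; rewrite -u1 mul1r => /addrI/oppr_inj.
Qed.

Lemma Bhg_finField (F : finFieldType) (g q h k : nat) :
    [pchar F]%R.-nat q -> 1 < q -> #|F| = q ^ h -> 0 < k -> k < h ->
    g %| (q ^ k).-1 -> g %| (q ^ h).-1 -> 1 < (q ^ h).-1 %/ g ->
  exists A : {set 'Z_((q ^ h).-1 %/ g)}, #|A| = q /\ Bhg h g A.
Proof.
move=> charq q_gt1 cardF k_gt0 lt_kh g_dv_k g_dv_h N_gt1.
have g_gt0: 0 < g by case: g N_gt1 {g_dv_k g_dv_h} => //; rewrite divn0.
set N := _ %/ g in N_gt1 *.
have [z] := finField_prim_root F; rewrite cardF => z_prim.
have uz := uniq_prim_root_conjugates q_gt1 (leq_ltn_trans k_gt0 lt_kh) z_prim.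
have nfix_z: (z ^+ (q ^ k) != z)%R.
  apply/negP=> /eqP zk; have h_gt0: 0 < h by apply: leq_trans lt_kh.
  (* Otherwise the entries [k] and 0 of the list of conjugates would coincide. *)
  have := nth_uniq 0%R _ _ uz; rewrite size_map size_iota => /(_ k 0 lt_kh h_gt0).
  rewrite !(nth_map 0) ?size_iota // !nth_iota // !add0n expn0 expr1 zk eqxx.
  by rewrite gtn_eqF.
pose K := [set x : F | x ^+ q == x]%R.
have inK x : x \in K -> (x ^+ q = x)%R by rewrite inE => /eqP.
pose P (x : F) := ((z - x) ^+ g)%R.
have P_inj : {in K &, injective P}.
  move=> x y /inK fix_x /inK fix_y.
  exact: (expr_subr_fixed_inj charq g_dv_k (ltnW q_gt1) nfix_z fix_x fix_y).
have w_prim : ((Zp_trunc N).+2).-primitive_root%R (z ^+ g)%R.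
  have eq_M : N * g = (q ^ h).-1 by rewrite divnK.
  rewrite Zp_cast //; have := @dvdn_prim_root _ _ _ z_prim N.
  by rewrite -eq_M mulKn ?(ltnW N_gt1) //; apply; apply: dvdn_mulr.
pose psi (x : 'Z_N) := ((z ^+ g) ^+ x)%R.
have psi_inj : injective psi := expr_Zp_inj w_prim.
pose A := [set x | psi x \in P @: K].
exists A; split.
  (* Both [psi] and [P] preserve cardinality here, so it suffices that [psi] maps [A] onto
     [P @: K]. *)
  rewrite -(card_imset _ psi_inj) -[RHS](card_expr_fixed q_gt1 cardF).
  rewrite -(card_in_imset P_inj); apply: eq_card => y.
  apply/imsetP/idP => [[x + ->]|]; first by rewrite inE.
  move=> PKy; have /imsetP[x /inK fix_x def_y] := PKy.
  have nz_zx: (z - x != 0)%R.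
    by apply: contra_neq nfix_z => /subr0_eq ->; apply: expr_fixed_iter.
  (* As [z - x] is nonzero and [N * g = q ^ h - 1], its [g]-th power is an [N]-th root of unity,
     hence a value of [psi]. *)
  have yN: (y ^+ (Zp_trunc N).+2 = 1)%R.
    rewrite Zp_cast // def_y -exprM mulnC divnK //; apply: (mulfI nz_zx).
    by rewrite -exprS -cardF prednK ?expf_card ?mulr1 // cardF expn_gt0 (ltnW q_gt1).
  by have [i def_i] := prim_rootP w_prim yN; exists i => //; rewrite inE /psi -def_i.
move=> b reps reps_b reps_pw.
(* The element of [K] that gives rise to [x]; the default 0 is reached only outside [A]. *)
pose c x := odflt 0%R [pick a in K | psi x == P a].
have cP x : x \in A -> c x \in K /\ psi x = P (c x).
  rewrite inE => /imsetP[a Ka def_x]; rewrite /c.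
  case: pickP => [a' /andP[Ka' /eqP]|/(_ a)] //=.
  by rewrite Ka def_x eqxx.
pose Q (t : h.-tuple 'Z_N) := (\prod_(x <- map c t) (z - x))%R.
(* The values of [Q] on [reps] are to be distinct solutions of [X ^ g = psi b]. *)
rewrite -(size_map Q); apply: (@uniq_roots_of_power _ _ (psi b)) => //.
  rewrite uniq_pairwise pairwise_map.
  apply: (sub_in_pairwise (P := mem reps)) reps_pw; last exact/allP.
  move=> t t' /reps_b[tA _] /reps_b[t'A _] /=; apply: contraNneq => eq_Q.
  have cK (s : h.-tuple 'Z_N) : {subset s <= A} ->
      {in map c s, forall x, x ^+ q = x}%R.
    by move=> sA _ /mapP[x /sA/cP[/inK fix_x _] ->].
  (* Equal products give the same multiset of [c]-values. Applying [P] turns these into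
     [psi]-values, and injectivity of [psi] recovers [t] and [t'] up to order. *)
  have := perm_eq_prod_fixed charq uz _ _ (cK t tA) (cK t' t'A) eq_Q.
  rewrite !size_map !size_tuple => /(_ erefl erefl)/(perm_map P).
  have PcE (s : h.-tuple 'Z_N) : {subset s <= A} -> map P (map c s) = map psi s.
    by move=> sA; rewrite -map_comp; apply/eq_in_map => x /sA/cP[].
  by rewrite !PcE //; apply: perm_map_inj.
(* [psi] turns the sum [b] into the product of the factors [P (c x)]. *)
move=> _ /mapP[t /reps_b[tA <-] ->]; rewrite /Q big_map -prodrXl.
rewrite big_tuple /psi (expr_Zp_sum w_prim); apply: eq_bigr => i _.
by have [_] := cP _ (tA _ (mem_tnth i t)).
Qed.

(* The hypotheses give g %| q ^ k - 1 with k <= h / 2, hence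
   (q ^ h - 1) / g >= q ^ k + 1 > 1, so that 'Z_N below is indeed Z/N. *)
Theorem theorem3p5 (g q h : nat) (hg : 0 < g) (hq : prime_power q)
    (hh : 2 <= h)
    (hk : exists k : nat,
        [/\ 0 < k, k %| h, k != h & (q ^ k = 1 %[mod g])]) :
  exists A : {set 'Z_((q ^ h - 1) %/ g)}, #|A| = q /\ Bhg h g A.
Proof.
case: hq => p [m [p_pr m_gt0 def_q]]; case: hk => k [k_gt0 k_dv_h k_neq_h qk1].
have q_gt1: 1 < q by rewrite def_q -(exp1n m) ltn_exp2r ?prime_gt1.
have h_gt0: 0 < h := ltnW hh.
have lt_kh: k < h by rewrite ltn_neqAle k_neq_h dvdn_leq.
have qk_gt1: 1 < q ^ k by rewrite -(exp1n k) ltn_exp2r.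
have g_dv_k: g %| (q ^ k).-1 by rewrite -subn1 -eqn_mod_dvd ?(ltnW qk_gt1) // qk1.
(* Since [k] divides [h], [q ^ h] is a power of [q ^ k]; hence the division by [g] in the modulus is
   exact. *)
have dv_kh: (q ^ k).-1 %| (q ^ h).-1.
  by case/dvdnP: k_dv_h => l ->; rewrite mulnC expnM dvdn_pred_predX.
have g_dv_h := dvdn_trans g_dv_k dv_kh.
have mh_gt0: 0 < m * h by rewrite muln_gt0 m_gt0.
have [F charF cardF] := pPrimePowerField p_pr mh_gt0.
rewrite subn1; apply: (Bhg_finField (F := F) (k := k)) => //.
- by rewrite def_q pnatX pnatE ?charF.
- by rewrite cardF expnM def_q.
rewrite ltn_divRL // mul1n (leq_ltn_trans (dvdn_leq _ g_dv_k)) //.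
  by rewrite -ltnS prednK // ltnW.
by rewrite -ltnS !prednK ?ltn_exp2l ?expn_gt0 ?(ltnW q_gt1).
Qed.
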